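(* Let $T>0$ and let $(W_t)_{0\le t\le T}$ and $(B_t)_{0\le t\le T}$ be two independent standard real Brownian motions. Define $$\bar\beta^T_t = W_t-\frac{t}{T}W_T+\frac{t}{T}B_t,\qquad 0\le t\le T.$$ Then the process $\bar\beta^T=(\bar\beta^T_t)_{0\le t\le T}$ is not a Markov process with respect to its natural filtration $\mathbb F^{\bar\beta^T}$.
   Context: The natural filtration $\mathbb F^{\bar\beta^T}=(\mathcal F^{\bar\beta^T}_t)_{0\le t\le T}$ is generated by the process: $\mathcal F^{\bar\beta^T}_t=\sigma(\bar\beta^T_s,\ s\le t)$. The Markov property is understood in the (possibly time-inhomogeneous) sense: for $s\le t$, the conditional law of $\bar\beta^T_t$ given $\mathcal F^{\bar\beta^T}_s$ equals its conditional law given $\bar\beta^T_s$. *)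

(* Defs.v *)
From HB Require Import structures.
From mathcomp Require Import all_boot all_order all_algebra.
From mathcomp Require Import all_classical all_reals all_analysis.

Set Implicit Arguments.
Unset Strict Implicit.
Unset Printing Implicit Defensive.

Import Order.TTheory GRing.Theory Num.Theory.
Import numFieldTopology.Exports numFieldNormedType.Exports.

Local Open Scope classical_set_scope.
Local Open Scope ring_scope.

Section StochasticProcesses.
Context {d : measure_display} {Omega : measurableType d} {R : realType}.
Variable P : probability Omega R.
Implicit Types (D : set R) (G H : set (set Omega)) (X : R -> Omega -> R).

(* Real-valued processes are indexed by all of R; only the times of the interval
   under consideration matter in the definitions below. *)

(* sigma(X_s, s \in D) *)
Definition sigma_process D X : set (set Omega) :=
  <<s \bigcup_(s in D) g_sigma_algebra_preimage (X s) >>.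

(* For a process with time set [0, T] and t \in [0, T]. *)
Definition natural_filtration X (t : R) : set (set Omega) :=
  sigma_process `[0, t] X.

Definition independent_sigma_algebras G H : Prop :=
  forall A B, G A -> H B -> P (A `&` B) = (P A * P B)%E.

Definition independent_processes (T : R) X Y : Prop :=
  independent_sigma_algebras (sigma_process `[0, T] X) (sigma_process `[0, T] Y).

(* The laws are compared on Borel sets only: the values of a measure on
   non-measurable sets are meaningless. The degenerate case s = t is left out
   because normal_prob with standard deviation 0 is not the Dirac mass. *)
Definition standard_brownian_motion (T : R) (W : R -> {RV P >-> R}) : Prop :=
  [/\ {ae P, forall w, W 0 w = 0},
      forall s t : R, 0 <= s -> s <= t -> t <= T ->
        independent_sigma_algebras (g_sigma_algebra_preimage (W t \- W s))
                                   (natural_filtration W s),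
      forall s t : R, 0 <= s -> s < t -> t <= T ->
        forall A : set R, measurable A ->
          pushforward P (W t \- W s) A = normal_prob 0 (Num.sqrt (t - s)) A
    & {ae P, forall w, {within `[0, T], continuous (fun t => W t w)}}].

(* f is a version of the conditional probability P(E | G), for a
   sub-sigma-algebra G *)
Definition is_conditional_probability G (E : set Omega) (f : Omega -> R) : Prop :=
  [/\ g_sigma_algebra_preimage f `<=` G,
      P.-integrable setT (EFin \o f)
    & forall C, G C -> (\int[P]_(w in C) (f w)%:E = P (E `&` C))%E].

(* The conditional law of X_t given G is the family of the conditional
   probabilities P(X_t \in A | G), A Borel; two such laws are equal when, for
   each A, any two versions agree almost surely. *)
Definition markov_process (T : R) X : Prop :=
  forall s t : R, 0 <= s -> s <= t -> t <= T ->
  forall A : set R, measurable A ->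
  forall f g : Omega -> R,
    is_conditional_probability (natural_filtration X s) (X t @^-1` A) f ->
    is_conditional_probability (g_sigma_algebra_preimage (X s)) (X t @^-1` A) g ->
    {ae P, forall w, f w = g w}.

End StochasticProcesses.

Arguments standard_brownian_motion {d Omega R} P T W.

Definition beta_bar {Omega : Type} {R : realType} (T : R) (W B : R -> Omega -> R)
    (t : R) (w : Omega) : R :=
  W t w - t / T * W T w + t / T * B t w.

(* Main.v *)
(** With h = T/4, the eight increments of W and B over the intervals
    [kh, (k+1)h] are independent with the same symmetric law N(0, h).  After a
    change of sign of the last two increments of W, the value of the process at
    time T/2 is half the sum of six of these variables; exchangeability alone
    then gives E[X_(T/4) | X_(T/2)] = 5/12 X_(T/2), where X = beta_bar T W B.
    If X were Markov, X_T = B_T and X_(T/4) would be conditionally independent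
    given X_(T/2), so Y := X_(T/4) - 5/12 X_(T/2) would have zero integral over
    {B_T > 0}.  But, again by exchangeability, Y + B_T / 24 has zero integral
    over {B_T > 0}, because its coefficients on the increments of W sum to 0 and
    so do those on the increments of B.  Hence B_T would have zero integral over
    {B_T > 0}, which is absurd. *)
From HB Require Import structures.
Require Import Defs.
From mathcomp Require Import all_boot all_order all_algebra.
From mathcomp Require Import all_classical all_reals all_analysis.
From mathcomp Require Import perm measurable_realfun ring lra.
Import Order.TTheory GRing.Theory Num.Theory.
Import numFieldTopology.Exports numFieldNormedType.Exports.
Local Open Scope ring_scope.
Local Open Scope classical_set_scope.

Set Implicit Arguments.
Unset Strict Implicit.
Unset Printing Implicit Defensive.

(** * Integrals over events, and a criterion for null sets *)

Section integrals.
Context {d : measure_display} {Omega : measurableType d} {R : realType}.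
Variable mu : {measure set Omega -> \bar R}.

Lemma integrable_indicM (D : Omega -> R) (C : set Omega) : measurable C ->
  mu.-integrable setT (EFin \o D) ->
  mu.-integrable setT (EFin \o (fun w => D w * \1_C w)).
Proof.
move=> mC iD.
rewrite (_ : _ \o _ = (EFin \o D) \* (EFin \o \1_C))%E; last exact/funext.
apply: integrableMl => //.
exists 1; split => // x x1 y _ /=.
rewrite indicE; case: (_ \in _); rewrite ?normr1 ?normr0 ltW//.
by rewrite (lt_trans _ x1).
Qed.

Lemma Rintegral_indicM (D : Omega -> R) (C : set Omega) :
  \int[mu]_w (D w * \1_C w) = \int[mu]_(w in C) D w.
Proof.
rewrite [RHS]Rintegral_mkcond; apply: eq_Rintegral => w _.
by rewrite patchE indicE; case: ifP => _; rewrite ?mulr1 ?mulr0.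
Qed.

(** On [A] the absolute value of [h] is [- h], so its integral over [A] is both nonnegative and
    nonpositive. Hence [h] vanishes almost everywhere on [A], where it is strictly negative. *)
Lemma null_set_lt0 (h : Omega -> R) (A := [set w | h w < 0]) :
  mu.-integrable setT (EFin \o h) -> (0 <= \int[mu]_(w in A) (h w)%:E)%E ->
  mu A = 0.
Proof.
move=> ih h0.
have mh : measurable_fun setT h by apply/measurable_EFinP/(measurable_int _ ih).
have mA : measurable A.
  rewrite (_ : A = setT `&` h @^-1` `]-oo, 0[); first exact: mh.
  by apply/seteqP; split => w /=; rewrite in_itv/=; tauto.
have ihA : mu.-integrable A (EFin \o h) by exact: integrableS ih.
have int0 : (\int[mu]_(w in A) `|(h w)%:E| = 0)%E.
  apply/eqP; rewrite eq_le integral_ge0// andbT.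
  rewrite (_ : (\int[mu]_(w in A) _ = - \int[mu]_(w in A) (h w)%:E)%E);
    last first.
    rewrite -integralN; last exact: integrable_add_def.
    by apply: eq_integral => w; rewrite inE /A/= => hw; rewrite ltr0_norm.
  by rewrite oppe_le0.
have /ae_eq_integral_abs : measurable_fun A (EFin \o h).
  exact: measurable_int ihA.
move=> /(_ mu mA)[+ _] => /(_ int0) hae.
apply/(measure_negligible mA)/negligibleS/hae => w /= hw; rewrite /A/=.
by move=> /(_ hw) [] h00; move: hw; rewrite /A/= h00 ltxx.
Qed.

End integrals.

(** * Conditioning on a sub-sigma-algebra *)

Section sub_sigma_algebra.
Context {d : measure_display} {Omega : measurableType d} {R : realType}.
Variables (mu : {measure set Omega -> \bar R}) (G : set (set Omega)).
Hypotheses (sigmaG : sigma_algebra setT G) (G_measurable : G `<=` measurable).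

(** The same points as [Omega], with the coarser sigma-algebra [G]: being measurable with respect to
    [G] becomes ordinary measurability on [TG]. *)
Let TG : measurableType G.-sigma := g_sigma_algebraType G.

Lemma sub_sigma_algebra_measurable (A : set TG) : measurable A -> G A.
Proof. by rewrite /measurable/= => mA; rewrite -(sigma_algebra_id sigmaG). Qed.

Lemma measurable_sub_sigma_algebra (Z : Omega -> R) :
  g_sigma_algebra_preimage Z `<=` G ->
  measurable_fun [set: TG] (Z : TG -> R).
Proof.
by move=> ZG _ A mA; apply: sub_sigma_algebra; apply: ZG; exists A.
Qed.

Lemma measurable_fun_sub_sigma_algebra (Z : TG -> R) :
  measurable_fun [set: TG] Z ->
  measurable_fun [set: Omega] (Z : Omega -> R).
Proof.
move=> mZ _ A mA; apply: G_measurable; apply: sub_sigma_algebra_measurable.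
exact: mZ.
Qed.

Import HBSimple HBNNSimple.

(** The integral of [D] times a simple function with level sets in [G] vanishes by linearity;
    increasing simple approximations of [Z] and dominated convergence give the general case. *)
Lemma Rintegral_mul_eq0_ge0 (D Z : Omega -> R) :
  mu.-integrable setT (EFin \o D) ->
  (forall C, G C -> \int[mu]_(w in C) D w = 0) ->
  g_sigma_algebra_preimage Z `<=` G -> (forall w, 0 <= Z w) ->
  mu.-integrable setT (EFin \o (D \* Z)) ->
  \int[mu]_w (D w * Z w) = 0.
Proof.
move=> iD D0 ZG Z0 iDZ.
have mZ := measurable_sub_sigma_algebra ZG.
pose ZG' : TG -> \bar R := fun w => (Z w)%:E.
have mEZ : measurable_fun setT ZG' by exact/measurable_EFinP.
(* The approximation is taken on [TG] rather than on [Omega], so that the level sets of each [Zn n]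
   belong to [G]. *)
pose Zn := nnsfun_approx measurableT mEZ.
have mD : measurable_fun setT D by apply/measurable_EFinP/measurable_int/iD.
have mZn n : measurable_fun setT (Zn n : Omega -> R).
  by apply: measurable_fun_sub_sigma_algebra; exact: measurable_funP.
have int0 n : (\int[mu]_w (D w * Zn n w)%:E = 0)%E.
  under eq_integral do rewrite fimfunEord mulr_sumr -sumEFin.
  have mpre r : G (Zn n @^-1` [set r]) by exact: sub_sigma_algebra_measurable.
  have iDi r := integrable_indicM (G_measurable (mpre r)) iD.
  rewrite integral_sum// => [|i].
    rewrite big1// => i _.
    under eq_integral do rewrite mulrCA EFinM.
    rewrite integralZl//; last exact: iDi.
    apply/eqP; rewrite mule_eq0; apply/orP; right; apply/eqP.
    rewrite -[LHS]fineK; last by apply: integrable_fin_num => //; exact: iDi.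
    by congr EFin; rewrite -[LHS]/(Rintegral _ _ _) Rintegral_indicM D0.
  under eq_fun do rewrite mulrCA EFinM.
  by apply: integrableZl => //; exact: iDi.
have cvgZ w : Zn n w @[n --> \oo] --> Z w.
  have /fine_cvgP[_] := @cvg_nnsfun_approx _ TG _ _ measurableT _ mEZ
    (fun w _ => Z0 w) w Logic.I.
  exact.
have ZnZ n w : Zn n w <= Z w.
  rewrite -(cvg_lim (@Rhausdorff R) (cvgZ w)).
  apply: (@nondecreasing_cvgn_le _ (fun n => Zn n w)).
    by move=> a b ab; exact/lefP/nd_nnsfun_approx.
  by apply/cvg_ex; exists (Z w); exact: cvgZ.
have := @dominated_convergence _ _ _ mu setT measurableT
  (fun n w => (D w * Zn n w)%:E) (fun w => (D w * Z w)%:E)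
  (fun w => `|(D w * Z w)%:E|)%E.
case.
- by move=> n; apply/measurable_EFinP/measurable_funM.
- exact: measurable_int iDZ.
- apply: aeW => w _ /=; apply/cvg_EFin; first by near=> n.
  by apply: cvgMl_tmp; exact: cvgZ.
- exact: integrable_abse.
- apply: aeW => w n _ /=.
  by rewrite lee_fin !normrM ler_wpM2l// !ger0_norm.
- move=> _ _; rewrite (_ : [sequence _]_n = cst 0%E); last exact/funext.
  move=> /(cvg_unique (@ereal_hausdorff R) (cvg_cst _)) h.
  by rewrite /Rintegral -h.
Unshelve. all: end_near.
Qed.

(** Says that a variable with conditional expectation 0 given [G] is orthogonal to every
    [G]-measurable factor. The positive and negative parts of [Z] are again [G]-measurable, which
    reduces it to the nonnegative case. *)
Lemma Rintegral_mul_eq0 (D Z : Omega -> R) :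
  mu.-integrable setT (EFin \o D) ->
  (forall C, G C -> \int[mu]_(w in C) D w = 0) ->
  g_sigma_algebra_preimage Z `<=` G ->
  mu.-integrable setT (EFin \o (D \* Z)) ->
  \int[mu]_w (D w * Z w) = 0.
Proof.
move=> iD D0 ZG iDZ.
have posG : G (Z @^-1` `[0, +oo[).
  by apply: ZG; exists `[0, +oo[; rewrite ?setTI.
pose C := Z @^-1` `[0, +oo[.
have CM : measurable C by exact: G_measurable.
pose Z1 := fun w => Z w * \1_C w; pose Z2 := fun w => - Z w * \1_(~` C) w.
have preG (h : Omega -> R) (mh : measurable_fun setT (h : TG -> R)) :
   g_sigma_algebra_preimage h `<=` G.
  by move=> _ [A mA <-]; apply: sub_sigma_algebra_measurable; exact: mh.
have mZ := measurable_sub_sigma_algebra ZG.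
have mC : measurable (C : set TG) by exact: sub_sigma_algebra.
have mZ1 : measurable_fun setT (Z1 : TG -> R) by apply: measurable_funM.
have mZ2 : measurable_fun setT (Z2 : TG -> R).
  apply: measurable_funM; first exact: measurableT_comp.
  by apply: measurable_indic; exact: measurableC.
have DZ1 w : D w * Z1 w = D w * Z w * \1_C w by rewrite mulrA.
have DZ2 w : D w * Z2 w = - (D w * Z w * \1_(~` C) w) by rewrite /Z2; ring.
have iDZ1 : mu.-integrable setT (EFin \o (D \* Z1)).
  apply: eq_integrable (integrable_indicM CM iDZ) => // w _ /=.
  by rewrite DZ1.
have iDZ2 : mu.-integrable setT (EFin \o (D \* Z2)).
  have := integrableN (integrable_indicM (measurableC CM) iDZ).
  apply: eq_integrable => // w _ /=.
  by rewrite DZ2.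
have -> : \int[mu]_w (D w * Z w) =
    \int[mu]_w (D w * Z1 w) - \int[mu]_w (D w * Z2 w).
  rewrite -RintegralB//; apply: eq_Rintegral => w _; rewrite DZ1 DZ2 opprK.
  by rewrite !indicE in_setC; case: (_ \in _) => /=; ring.
rewrite !Rintegral_mul_eq0_ge0 ?subr0//.
- exact: preG.
- move=> w; rewrite /Z2 indicE in_setC; have [|] := boolP (w \in C) => /=.
    by rewrite mulr0.
  rewrite notin_setE /C/= in_itv/= andbT mulr1 => /negP.
  rewrite -ltNge oppr_ge0.
  exact: ltW.
- exact: preG.
- move=> w; rewrite /Z1 indicE; have [|] := boolP (w \in C) => /=;
    last by rewrite mulr0.
  by rewrite inE /C/= in_itv/= andbT mulr1.
Qed.

Variable P : probability Omega R.

(** The Markov property as defined speaks of given versions, so using it requires exhibiting some.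
    The version is the Radon-Nikodym derivative of [A |-> P (E]&[A)] with respect to the restriction
    of [P] to [G]. *)
Lemma conditional_probability_exists (E : set Omega) : measurable E ->
  exists f, is_conditional_probability P G E f.
Proof.
move=> mE.
have mid : measurable_fun [set: Omega] (id : Omega -> TG).
  move=> _ A mA; rewrite setTI; exact/G_measurable/sub_sigma_algebra_measurable.
(* Pushing a measure forward along the identity from [Omega] to [TG] restricts it to [G]. *)
pose idG : {mfun Omega >-> TG} := HB.pack (id : Omega -> TG)
  (isMeasurableFun.Build _ _ _ _ _ mid).
pose PG := distribution P idG.
have PEoo : (P E < +oo)%E by rewrite (le_lt_trans (probability_le1 _ _)) ?ltry.
have [nu nuE] : exists nu : {charge set TG -> \bar R},
    forall A, nu A = P (E `&` A).
  unshelve eexists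
    (pushforward (charge_of_finite_measure (mfrestr mE PEoo)) idG).
    exact: mid.
  by move=> A; rewrite /= /pushforward /= setIC.
have numu : nu `<< PG.
  apply/null_content_dominatesP => A mA.
  rewrite /PG/= /distribution/= /pushforward/= nuE => A0.
  have mA' : measurable (A : set Omega).
    by apply: G_measurable; exact: sub_sigma_algebra_measurable.
  by apply: (subset_measure0 _ _ _ A0) => //; exact: measurableI.
pose f := Radon_Nikodym nu PG.
have ffin w : f w \is a fin_num by exact: Radon_Nikodym_fin_num.
have fE w : f w = (fine (f w))%:E by rewrite fineK.
have if_ : PG.-integrable setT f by exact: Radon_Nikodym_integrable.
have mf : measurable_fun setT f by exact: measurable_int if_.
have ifP : P.-integrable setT (f \o idG).
  move: if_ => /integrableP[_].
  rewrite ge0_integral_distribution//; last exact: measurableT_comp.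
  move=> foo; apply/integrableP; split => //.
  exact: measurableT_comp.
have mff : measurable_fun [set: TG] (fun w => fine (f w)).
  exact: measurableT_comp.
exists (fun w => fine (f w)); split.
- by move=> _ [A mA <-]; apply: sub_sigma_algebra_measurable; exact: mff.
- by apply: eq_integrable ifP => // w _ /=; rewrite -fE.
- move=> C GC.
  have mC : measurable (C : set TG) by exact: sub_sigma_algebra.
  rewrite -nuE (Radon_Nikodym_integral numu mC).
  rewrite (@integral_pushforward _ _ Omega TG _ idG mid P C f mf) //=.
    by apply: eq_integral => w _ /=; rewrite -fE.
  by apply: integrableS ifP => //; exact: G_measurable.
Qed.

(** Truncating a version to [0, 1] changes it only on a null set: [null_set_lt0] applies to [f] and
    to [1 - f], whose integrals over sets of [G] are nonnegative. Bounded versions keep products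
    with integrable variables integrable. *)
Lemma conditional_probability_exists01 (E : set Omega) : measurable E ->
  exists2 f, is_conditional_probability P G E f & forall w, 0 <= f w <= 1.
Proof.
move=> mE; have [f [fG fi fE]] := conditional_probability_exists mE.
have mf := measurable_sub_sigma_algebra fG.
pose g w := Num.max 0 (Num.min 1 (f w)).
have mg : measurable_fun setT (g : TG -> R).
  by apply: measurable_maxr => //; exact: measurable_minr.
have GE C : G C -> measurable C by exact: G_measurable.
have G0 : G [set w | f w < 0].
  apply: fG; exists `]-oo, 0[ => //.
  by apply/seteqP; split => w /=; rewrite in_itv/=; tauto.
have G1 : G [set w | 1 - f w < 0].
  apply: fG; exists `]1, +oo[ => //.
  by apply/seteqP; split => w /=; rewrite in_itv/= andbT subr_lt0; tauto.
have i1f : P.-integrable setT (EFin \o (fun w => 1 - f w)).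
  have i1 := finite_measure_integrable_cst P 1 measurableT.
  by apply: eq_integrable (integrableB measurableT i1 fi).
have f0 := null_set_lt0 fi; rewrite fE// in f0.
have f1 := null_set_lt0 i1f.
have fg : {ae P, forall w, f w = g w}.
  have N0 : P.-negligible [set w | f w < 0].
    by apply/negligibleP; [exact: GE|exact: f0].
  have N1 : P.-negligible [set w | 1 - f w < 0].
    have mN1 := GE _ G1; apply/negligibleP => //.
    (* Over a set [C] of [G], the integral of [1 - f] is [P C - P (E]&[C)], which is nonnegative. *)
    apply: f1; under eq_integral do rewrite EFinB.
    rewrite integralB_EFin//.
    - rewrite integral_cst// mul1e fE// sube_ge0.
        by apply: le_measure; rewrite ?inE//; exact: measurableI.
      by rewrite orbC fin_num_measure.
    - exact: finite_measure_integrable_cst.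
    - exact: integrableS fi.
  apply: negligibleS (negligibleU N0 N1) => w /= fgw.
  apply: contrapT => /not_orP[/negP + /negP].
  rewrite -!leNgt subr_ge0 => f0w f1w.
  by apply: fgw; rewrite /g (min_idPr f1w) (max_idPr f0w).
exists g; last first.
  by move=> w; rewrite /g le_max lexx/= ge_max ler01/= ge_min lexx.
have mgP := measurable_fun_sub_sigma_algebra mg.
split.
- by move=> _ [A mA <-]; apply: sub_sigma_algebra_measurable; exact: mg.
- apply: le_integrable fi => //; first exact/measurable_EFinP.
  move=> w _ /=; rewrite lee_fin [leLHS]ger0_norm ?le_max ?lexx//.
  by rewrite ge_max normr_ge0/= ge_min ler_norm orbT.
- move=> C GC; rewrite -fE//; apply: ae_eq_integral; first exact: GE.
  + exact/measurable_EFinP/measurable_funTS.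
  + by apply: measurable_funTS; exact: measurable_int fi.
  + by apply: filterS fg => w fgw _; rewrite fgw.
Qed.

End sub_sigma_algebra.


(** * Exchangeability of finite i.i.d. families *)

Section exchangeability.
Context {d : measure_display} {Omega : measurableType d} {R : realType}.
Variables (P : probability Omega R) (I : finType).
Implicit Types (U V : I -> Omega -> R) (nu : set R -> \bar R).

(** Generators of the product Borel sigma-algebra on [I -> R]. *)
Definition rectangles : set (set (I -> R)) :=
  [set D | exists2 A : I -> set R, (forall i, measurable (A i)) &
    D = [set x | forall i, A i (x i)]].

Let RI : measurableType rectangles.-sigma := g_sigma_algebraType rectangles.

Lemma measurable_coordinate i : measurable_fun [set: RI] (fun x : RI => x i).
Proof.
move=> _ B mB; rewrite setTI; apply: sub_sigma_algebra.
exists (fun k => if k == i then B else setT).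
  by move=> k; case: ifP.
apply/seteqP; split => x /=.
  by move=> Bx k; case: eqP => // ->.
by move=> /(_ i); rewrite eqxx.
Qed.

Lemma measurable_family_event U (A : I -> set R) :
  (forall i, measurable_fun setT (U i)) -> (forall i, measurable (A i)) ->
  measurable [set w | forall i, A i (U i w)].
Proof.
move=> mU mA.
rewrite (_ : [set _ | _] = \bigcap_(i in [set: I]) (U i @^-1` A i)).
  apply: fin_bigcap_measurable => // i _.
  by rewrite -[X in measurable X]setTI; exact: mU.
by apply/seteqP; split => [w h i _|w h i]; exact: h.
Qed.

Lemma measurable_family U : (forall i, measurable_fun setT (U i)) ->
  measurable_fun [set: Omega] ((fun w i => U i w) : Omega -> RI).
Proof.
move=> mU; apply: (@measurability _ _ Omega RI setT _ rectangles) => //.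
by move=> _ [_ [A mA ->] <-]; rewrite setTI; exact: measurable_family_event.
Qed.

(** Rectangles are stable under intersection and generate the product sigma-algebra, so the two
    joint laws coincide; both integrals are then integrals of [phi] over [D] under this common
    law. *)
Lemma eq_law_Rintegral U V (phi : (I -> R) -> R) (D : set (I -> R)) :
  (forall i, measurable_fun setT (U i)) ->
  (forall i, measurable_fun setT (V i)) ->
  (forall A, (forall i, measurable (A i)) ->
    P [set w | forall i, A i (U i w)] = P [set w | forall i, A i (V i w)]) ->
  measurable_fun [set: RI] phi -> measurable (D : set RI) ->
  P.-integrable setT (fun w => (phi (U ^~ w))%:E) ->
  P.-integrable setT (fun w => (phi (V ^~ w))%:E) ->
  \int[P]_(w in [set w | D (U ^~ w)]) phi (U ^~ w) =
  \int[P]_(w in [set w | D (V ^~ w)]) phi (V ^~ w).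
Proof.
move=> mU mV UV mphi mD iU iV.
pose fU : {mfun Omega >-> RI} := HB.pack ((fun w i => U i w) : Omega -> RI)
  (isMeasurableFun.Build _ _ _ _ _ (measurable_family mU)).
pose fV : {mfun Omega >-> RI} := HB.pack ((fun w i => V i w) : Omega -> RI)
  (isMeasurableFun.Build _ _ _ _ _ (measurable_family mV)).
pose phiE : RI -> \bar R := fun x => (phi x)%:E.
have mphiE : measurable_fun setT phiE by exact/measurable_EFinP.
have law A : measurable A -> distribution P fU A = distribution P fV A.
  apply: (@measure_unique _ R RI rectangles (fun=> setT) _ _ _ _
    (distribution P fU) (distribution P fV)) => //.
  - move=> _ _ [A1 mA1 ->] [A2 mA2 ->]; exists (fun i => A1 i `&` A2 i).
      by move=> i; exact: measurableI.
    apply/seteqP; split => x /= => [[h1 h2] i|h]; first by split.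
    by split => i; case: (h i).
  - by move=> _; exists (fun=> setT) => //; apply/seteqP; split.
  - by rewrite bigcup_const.
  - by move=> _ [A' mA' ->]; exact: UV.
  - by move=> _; rewrite (le_lt_trans (probability_le1 _ _)) ?ltry.
have push (f : {mfun Omega >-> RI}) : P.-integrable setT (phiE \o f) ->
    (\int[P]_(w in f @^-1` D) (phiE (f w)) =
     \int[distribution P f]_(x in D) phiE x)%E.
  move=> iphi; rewrite [RHS]integral_pushforward//.
  apply: integrableS iphi => //.
  by rewrite -[X in measurable X]setTI; exact: measurable_funP.
rewrite /Rintegral; congr fine.
rewrite -[LHS]/(\int[P]_(w in fU @^-1` D) (phiE (fU w)))%E push//.
rewrite -[RHS]/(\int[P]_(w in fV @^-1` D) (phiE (fV w)))%E push//.
by apply: eq_measure_integral => A mA _; exact: law.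
Qed.

(** One product formula carries both independence and the common law: for a probability [nu], taking
    all but one of the sets full recovers the law of each variable. *)
Definition iid nu U :=
  (forall i, measurable_fun setT (U i)) /\
  forall A : I -> set R, (forall i, measurable (A i)) ->
    (P [set w | forall i, A i (U i w)] = \prod_(i : I) nu (A i))%E.

Lemma iid_involution nu U (s : I -> I) : involutive s ->
  iid nu U -> iid nu (fun i => U (s i)).
Proof.
move=> sK [mU lU]; split=> [i|A mA]; first exact: mU.
rewrite (reindex_inj (inv_inj sK))/= -lU => [|i]; last exact: mA.
congr (P _); apply/seteqP; split => w h i; last by have := h (s i); rewrite sK.
by have := h (s i); rewrite sK.
Qed.

(** The transposition of [i] and [j] preserves the joint law and, since [c i = c j], also the
    conditioning event, while it turns [U i] into [U j]. *)
Lemma Rintegral_exchange nu U (c : I -> R) (C : set R) i j :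
  iid nu U -> (forall i, P.-integrable setT (EFin \o U i)) ->
  c i = c j -> measurable C ->
  \int[P]_(w in [set w | C (\sum_k c k * U k w)]) U i w =
  \int[P]_(w in [set w | C (\sum_k c k * U k w)]) U j w.
Proof.
move=> iidU iU cij mC.
have [mU lU] := iidU; have [mV lV] := iid_involution (@tpermK _ i j) iidU.
pose D : set (I -> R) := [set x | C (\sum_k c k * x k)].
have mD : measurable (D : set RI).
  rewrite -[D]setTI.
  have h : measurable_fun [set: RI] (fun x : RI => \sum_k c k * x k).
    apply: measurable_sum => k; apply: measurable_funM => //.
    exact: measurable_coordinate.
  exact: h.
rewrite -[LHS]/(\int[P]_(w in [set w | D (U ^~ w)]) (fun x => x i) (U ^~ w)).
rewrite (@eq_law_Rintegral U (fun k => U (tperm i j k)) (fun x => x i))//=.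
- rewrite tpermL; congr (Rintegral _ _ _).
  apply/funext => w; congr C.
  rewrite (reindex_inj (@perm_inj _ (tperm i j)))/=; apply: eq_bigr => k _.
  by rewrite tpermK; case: tpermP => [->|->|//]; rewrite cij.
- by move=> A mA; rewrite lU// lV.
- exact: measurable_coordinate.
- exact: iU.
- exact: iU.
Qed.

(** All [U i] with [i] in [K] have the same integral over the event, so the sum is that common value
    times the sum of the [y i]. This replaces any computation with Gaussian covariances. *)
Lemma Rintegral_exchange_sum nu U (c y : I -> R) (C : set R) (K : pred I)
    (a : R) :
  iid nu U -> (forall i, P.-integrable setT (EFin \o U i)) ->
  measurable C -> (forall i, K i -> c i = a) -> \sum_(i | K i) y i = 0 ->
  \int[P]_(w in [set w | C (\sum_k c k * U k w)])
    (\sum_(i | K i) y i * U i w) = 0.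
Proof.
move=> iidU iU mC cK yK.
set E := [set w | _].
have mE : measurable E.
  have mS : measurable_fun setT (fun w => \sum_k c k * U k w).
    by apply: measurable_sum => k; apply: measurable_funM => //; case: iidU.
  by rewrite -[E]setTI; exact: mS.
have iUE i : P.-integrable E (EFin \o U i) by exact: integrableS (iU i).
(* The index [i0] names the common value of the integrals; if [K] is empty the integrand is 0. *)
have [i0 i0K|K0] := pickP K; last first.
  rewrite /Rintegral; under eq_integral do rewrite big_pred0//.
  by rewrite integral0.
transitivity (\sum_(i | K i) y i * \int[P]_(w in E) U i w).
  rewrite /Rintegral; under eq_integral do rewrite -sumEFin.
  rewrite integral_sum//; last first.
    by move=> i; have := integrableZl mE (y i) (iUE i).
  have h i : (\int[P]_(w in E) (y i * U i w)%:E =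
      (y i * \int[P]_(w in E) U i w)%:E)%E.
    under eq_integral do rewrite EFinM.
    rewrite integralZl//; last exact: iUE.
    by rewrite -[X in (_ * X)%E]fineK//; exact: integrable_fin_num (iUE i).
  by under eq_bigr do rewrite h; rewrite sumEFin.
under eq_bigr => i iK.
  rewrite (Rintegral_exchange iidU iU (_ : c i = c i0))// ?cK//.
  over.
by rewrite -mulr_suml yK mul0r.
Qed.

(** A change of sign of [U i] is a reflection of the set [A i], which [nu] does not see. *)
Lemma iid_sign nu U (e : I -> bool) :
  (forall A : set R, measurable A -> nu [set x | A (- x)] = nu A) ->
  iid nu U -> iid nu (fun i w => (-1) ^+ e i * U i w).
Proof.
move=> nuN [mU lU]; split=> [i|A mA]; first exact: measurable_funM.
pose A' i := if e i then [set x | A i (- x)] else A i.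
have mA' i : measurable (A' i).
  rewrite /A'; case: (e i) => //; rewrite -[X in measurable X]setTI.
  exact: (@oppr_measurable R setT).
rewrite -[LHS]/(P [set w | forall i, A i ((-1) ^+ e i * U i w)]).
rewrite (_ : [set w | _] = [set w | forall i, A' i (U i w)]).
  rewrite lU//; apply: eq_bigr => i _; rewrite /A'; case: (e i) => //.
  exact: nuN.
apply/seteqP; split=> w h i; have := h i; rewrite /A'; case: (e i).
- by rewrite expr1 mulN1r.
- by rewrite expr0 mul1r.
- by rewrite expr1 mulN1r.
- by rewrite expr0 mul1r.
Qed.

End exchangeability.

(** * Symmetry, first moment and positivity for centred normal laws *)

Section normal_law.
Context {R : realType}.
Variable sigma : R.
Hypothesis sigma_neq0 : sigma != 0.
Local Notation lambda := (@lebesgue_measure R).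

(** The abstract Radon-Nikodym derivative agrees with [normal_pdf] almost everywhere, since both
    have the same integral over every measurable set. *)
Lemma ge0_integral_normal_prob (f : R -> \bar R) :
  measurable_fun setT f -> (forall x, 0 <= f x)%E ->
  (\int[normal_prob 0 sigma]_x f x =
   \int[lambda]_x (f x * (normal_pdf 0 sigma x)%:E))%E.
Proof.
move=> mf f0.
have dom := normal_prob_dominates (0 : R) sigma.
rewrite -(Radon_Nikodym_SigmaFinite.change_of_variables dom)//=.
have mpdf : measurable_fun setT (fun x : R => (normal_pdf 0 sigma x)%:E).
  apply/measurable_EFinP; exact: measurable_normal_pdf.
apply: ae_eq_integral => //.
- apply: emeasurable_funM => //.
  exact: measurable_int (Radon_Nikodym_SigmaFinite.f_integrable dom).
- exact: emeasurable_funM.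
- apply: ae_eqe_mul2l.
  apply: integral_ae_eq => //.
  + exact: Radon_Nikodym_SigmaFinite.f_integrable.
  + by move=> A _ mA; rewrite -Radon_Nikodym_SigmaFinite.f_integral.
Qed.

Lemma normal_pdf_sym x : normal_pdf 0 sigma (- x) = normal_pdf 0 sigma x.
Proof. by rewrite !normal_pdfE// /normal_fun !subr0 sqrrN. Qed.

Lemma normal_prob_sym (A : set R) : measurable A ->
  normal_prob 0 sigma [set x | A (- x)] = normal_prob 0 sigma A.
Proof.
move=> mA; rewrite /normal_prob.
pose opp : measurableTypeR R -> measurableTypeR R := -%R.
have mN : measurable_fun setT opp by exact: oppr_measurable.
transitivity
    (\int[pushforward lambda opp]_(x in A) (normal_pdf 0 sigma x)%:E)%E;
  last first.
  by apply: eq_measure_integral => B mB _; exact: lebesgue_measureN.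
rewrite ge0_integral_pushforward//.
- by apply: eq_integral => x _ /=; rewrite normal_pdf_sym.
- apply: measurable_funTS; apply/measurable_EFinP.
  exact: measurable_normal_pdf.
- by move=> x _; rewrite lee_fin normal_pdf_ge0.
Qed.

Lemma abs_moment_normal_prob_lty :
  (\int[normal_prob 0 sigma]_x `|x%:E| < +oo)%E.
Proof.
have mabs : measurable_fun setT (fun x : R => `|x%:E|%E).
  exact: measurableT_comp.
have mpdf s : measurable_fun setT (fun x : R => (normal_pdf 0 s x)%:E).
  by apply/measurable_EFinP; exact: measurable_normal_pdf.
rewrite ge0_integral_normal_prob//.
(* Doubling the variance halves the exponent: with [a] as below the two densities are multiples of
   [expR (- a - a)] and [expR (- a)]. The spare factor [expR (- a)] absorbs [|x|], and [K] also
   corrects the ratio of the peaks. *)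
pose tau := Num.sqrt 2 * sigma.
have tau0 : tau != 0 by rewrite mulf_neq0// gt_eqF// sqrtr_gt0.
have s2 : 0 < sigma ^+ 2 by rewrite exprn_even_gt0.
have p0 : 0 < normal_peak tau by exact: normal_peak_gt0.
pose K := (1 + 4 * sigma ^+ 2) * (normal_peak sigma / normal_peak tau).
have le_pdf x : `|x| * normal_pdf 0 sigma x <= K * normal_pdf 0 tau x.
  rewrite !normal_pdfE// /K /normal_fun !subr0.
  pose a := x ^+ 2 / (4 * sigma ^+ 2).
  have -> : - x ^+ 2 / (sigma ^+ 2 *+ 2) = - a - a by rewrite /a; field.
  have -> : - x ^+ 2 / (tau ^+ 2 *+ 2) = - a.
    by rewrite /a /tau exprMn sqr_sqrtr//; field.
  have a0 : 0 <= a by rewrite divr_ge0 ?sqr_ge0// mulr_ge0// ltW.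
  (* From [2 |x| <= 1 + x ^+ 2], [x ^+ 2 = 4 * sigma ^+ 2 * a] and [1 + a <= expR a]. *)
  have xa : `|x| <= (1 + 4 * sigma ^+ 2) * expR a.
    have x2a : `|x| ^+ 2 = 4 * sigma ^+ 2 * a.
      by rewrite real_normK ?num_real// /a; field.
    have := expR_ge1Dx a; have := sqr_ge0 (`|x| - 1); move: (expR a) => ea.
    move: (sigma ^+ 2) s2 x2a => s s0; nra.
  rewrite [leRHS](_ : _ =
      normal_peak sigma * ((1 + 4 * sigma ^+ 2) * expR (- a))).
    rewrite mulrCA ler_wpM2l ?normal_peak_ge0//.
    rewrite expRD mulrA ler_wpM2r ?expR_ge0//.
    by rewrite expRN ler_pdivrMr ?expR_gt0.
  by field; rewrite gt_eqF.
apply: (@le_lt_trans _ _ (\int[lambda]_x (K%:E * (normal_pdf 0 tau x)%:E))%E).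
  apply: ge0_le_integral => //.
  - by move=> x _; rewrite mule_ge0// lee_fin normal_pdf_ge0.
  - by apply: emeasurable_funM => //; exact: mpdf.
  - by apply: emeasurable_funM => //; exact: mpdf.
  - by move=> x _; rewrite -!EFinM lee_fin le_pdf.
rewrite integralZl//; last exact: integrable_normal_pdf.
by rewrite integral_normal_pdf mule1 ltry.
Qed.

(** Otherwise both open half-lines would be null by symmetry, and {0} is null by absolute
    continuity, so the total mass would be 0. *)
Lemma normal_prob_gt0 : (0 < normal_prob 0 sigma [set x : R | (0 < x)%R])%E.
Proof.
have pm : measurable [set x : R | 0 < x].
  rewrite (_ : [set _ | _] = `]0, +oo[)//.
  by apply/seteqP; split => x /=; rewrite in_itv/= andbT.
have nm : measurable [set x : R | 0 < - x].
  rewrite (_ : [set _ | _] = `]-oo, 0[)//.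
  by apply/seteqP; split => x /=; rewrite in_itv/= oppr_gt0.
rewrite lt0e measure_ge0 andbT; apply/eqP => p0.
have n0 : normal_prob 0 sigma [set x : R | 0 < - x] = 0%E.
  by rewrite (normal_prob_sym pm).
have z0 : normal_prob 0 sigma [set (0 : R)] = 0%E.
  have /null_content_dominatesP := normal_prob_dominates (0 : R) sigma.
  by apply => //; exact: lebesgue_measure_set1.
have : normal_prob 0 sigma [set: R] = 1%E by exact: probability_setT.
have -> : [set: R] = [set x : R | 0 < x] `|` [set x : R | 0 < - x] `|` [set 0].
  apply/seteqP; split => x //= _; rewrite oppr_gt0.
  by case: (ltgtP x 0) => h; [left; right|left; left|right].
rewrite !null_set_setU//; last exact: measurableU.
by move=> /eqP; rewrite eqe eq_sym oner_eq0.
Qed.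

End normal_law.

(** * Consequences of the Markov property for integrals *)

Section processes.
Context {d : measure_display} {Omega : measurableType d} {R : realType}.
Variable P : probability Omega R.
Implicit Types (X : R -> Omega -> R) (D : set R).

Let coordinate_events D X : set (set Omega) :=
  \bigcup_(s in D) g_sigma_algebra_preimage (X s).

Lemma measurable_sigma_process D X s : D s ->
  measurable_fun [set: g_sigma_algebraType (coordinate_events D X)] (X s).
Proof.
by move=> Ds _ A mA; apply: sub_sigma_algebra; exists s => //; exists A.
Qed.

Lemma sigma_algebra_sigma_process D X : sigma_algebra setT (sigma_process D X).
Proof. exact: smallest_sigma_algebra. Qed.

Lemma sigma_process_measurable D X :
  (forall s, D s -> measurable_fun setT (X s)) ->
  sigma_process D X `<=` measurable.
Proof.
move=> mX; apply: smallest_sub; first exact: sigma_algebra_measurable.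
by move=> _ [s Ds [A mA <-]]; exact: mX.
Qed.

Lemma sigma_process_coordinate D X s : D s ->
  g_sigma_algebra_preimage (X s) `<=` sigma_process D X.
Proof. by move=> Ds A XA; apply: sub_sigma_algebra; exists s. Qed.

(** The difference of [f] and the indicator of [E] has zero integral over every set of [G], hence is
    orthogonal to [Z]. *)
Lemma conditional_probability_Rintegral (G : set (set Omega)) (E : set Omega)
    (f Z : Omega -> R) :
  sigma_algebra setT G -> G `<=` measurable -> measurable E ->
  is_conditional_probability P G E f -> (forall w, 0 <= f w <= 1) ->
  g_sigma_algebra_preimage Z `<=` G -> P.-integrable setT (EFin \o Z) ->
  \int[P]_w (f w * Z w) = \int[P]_(w in E) Z w.
Proof.
move=> sG mG mE [fG fi fE] f01 ZG Zi.
have mf : measurable_fun setT f by apply/measurable_EFinP/(measurable_int _ fi).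
have iE : P.-integrable setT (EFin \o \1_E) by exact: integrable_indic.
have iD : P.-integrable setT (EFin \o (f \- \1_E)).
  by apply: eq_integrable (integrableB measurableT fi iE).
have ifZ : P.-integrable setT (EFin \o (f \* Z)).
  apply: eq_integrable (integrableMr measurableT mf _ Zi) => //.
  exists 1; split => // x x1 w _ /=; have /andP[f0 f1] := f01 w.
  by rewrite ger0_norm// (le_trans f1)// ltW.
have iEZ := integrable_indicM mE Zi.
rewrite -(Rintegral_indicM P Z E).
apply/eqP; rewrite -subr_eq0 -RintegralB//; apply/eqP.
rewrite -[RHS](@Rintegral_mul_eq0 _ _ _ P G sG mG (f \- \1_E) Z)//.
- by apply: eq_Rintegral => w _ /=; ring.
- move=> C GC; have mC := mG _ GC.
  rewrite RintegralB//; [|exact: integrableS fi|exact: integrableS iE].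
  by rewrite /Rintegral fE// integral_indic// subrr.
- apply: eq_integrable (integrableB measurableT ifZ iEZ) => // w _ /=.
  by rewrite -EFinB; congr EFin; ring.
Qed.

(** If [e * X s] is the conditional expectation of the past value [X r] given the present [X s], the
    residual also has zero integral over events of the future [X t]: by the Markov property the
    indicator of such an event can be replaced by a function [g] of the present. *)
Lemma markov_regression (T : R) X (r s t e : R) (A : set R) :
  (forall u, 0 <= u <= t -> measurable_fun setT (X u)) ->
  markov_process P T X ->
  0 <= r -> r <= s -> s <= t -> t <= T -> measurable A ->
  P.-integrable setT (EFin \o X r) -> P.-integrable setT (EFin \o X s) ->
  (forall C, measurable C ->
    \int[P]_(w in X s @^-1` C) (X r w - e * X s w) = 0) ->
  \int[P]_(w in X t @^-1` A) (X r w - e * X s w) = 0.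
Proof.
move=> mX markovX r0 rs st tT mA ir is_ reg.
have s0 : 0 <= s by exact: le_trans rs.
have mXs : measurable_fun setT (X s) by apply: mX; rewrite s0.
have mE : measurable (X t @^-1` A).
  rewrite -[X in measurable X]setTI; apply: mX => //.
  by rewrite lexx (le_trans s0).
pose F := natural_filtration X s; pose S := g_sigma_algebra_preimage (X s).
have sF : sigma_algebra setT F by exact: sigma_algebra_sigma_process.
have mF : F `<=` measurable.
  apply: sigma_process_measurable => u /=; rewrite in_itv/= => /andP[u0 us].
  by apply: mX; rewrite u0 (le_trans us).
have sS : sigma_algebra setT S.
  by apply: sigma_algebra_preimage; exact: sigma_algebra_measurable.
have mS : S `<=` measurable by move=> _ [C mC <-]; exact: mXs.
have [f fP f01] := conditional_probability_exists01 sF mF P mE.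
have [g gP g01] := conditional_probability_exists01 sS mS P mE.
have fg := markovX _ _ s0 st tT A mA f g fP gP.
have [gS gi _] := gP.
have mf : measurable_fun setT f.
  by case: fP => _ fi _; apply/measurable_EFinP/(measurable_int _ fi).
have mg : measurable_fun setT g by apply/measurable_EFinP/(measurable_int _ gi).
have igZ Z : P.-integrable setT (EFin \o Z) ->
    P.-integrable setT (EFin \o (g \* Z)).
  move=> Zi; apply: eq_integrable (integrableMr measurableT mg _ Zi) => //.
  exists 1; split => // x x1 w _ /=; have /andP[g0 g1] := g01 w.
  by rewrite ger0_norm// (le_trans g1)// ltW.
have ies : P.-integrable setT (EFin \o (fun w => e * X s w)).
  by apply: eq_integrable (integrableZl measurableT e is_).
have iY : P.-integrable setT (EFin \o (fun w => X r w - e * X s w)).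
  by apply: eq_integrable (integrableB measurableT ir ies).
(* The only use of the Markov property: [X r] is measurable for the past [F] but in general not for
   [S], so the formula holds first with [f], and then with [g], which equals [f] almost surely. *)
have Er : \int[P]_(w in X t @^-1` A) X r w = \int[P]_w (g w * X r w).
  rewrite -(conditional_probability_Rintegral sF mF mE fP f01 _ ir); last first.
    by apply: sigma_process_coordinate; rewrite /= in_itv/= r0.
  rewrite /Rintegral; congr fine; apply: ae_eq_integral => //.
  - apply/measurable_EFinP/measurable_funM => //.
    by apply/measurable_EFinP/(measurable_int _ ir).
  - exact: measurable_int (igZ _ ir).
  - by apply: filterS fg => w -> _.
have Es : \int[P]_(w in X t @^-1` A) X s w = \int[P]_w (g w * X s w).
  by rewrite -(conditional_probability_Rintegral sS mS mE gP g01 _ is_).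
rewrite RintegralB//; [|exact: integrableS ir|exact: integrableS ies].
rewrite RintegralZl//; last exact: integrableS is_.
rewrite Er Es -RintegralZl//; last exact: igZ.
rewrite -RintegralB//; last 2 first.
- exact: igZ.
- apply: eq_integrable (integrableZl measurableT e (igZ _ is_)) => //.
rewrite -[RHS](@Rintegral_mul_eq0 _ _ _ P S sS mS
  (fun w => X r w - e * X s w) g)//.
- by apply: eq_Rintegral => w _ /=; ring.
- by move=> _ [C mC <-]; rewrite setTI; exact: reg.
- by apply: eq_integrable (igZ _ iY) => // w _ /=; rewrite mulrC.
Qed.

End processes.

(** * Increments of one Brownian motion on a regular grid *)

Section brownian_increments.
Context {d : measure_display} {Omega : measurableType d} {R : realType}.
Variable P : probability Omega R.
Local Notation N := (@normal_prob R 0).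

Lemma probability_ae_eq (A B : set Omega) : measurable A -> measurable B ->
  {ae P, forall w, A w <-> B w} -> P A = P B.
Proof.
move=> mA mB AB; rewrite -[A]setIT -[B]setIT -!integral_indic//.
apply: ae_eq_integral => //; [exact/measurable_EFinP|exact/measurable_EFinP|].
apply: filterS AB => w [AB BA] _; congr (_%:E); rewrite !indicE.
by congr ((_ : bool)%:R); apply/idP/idP; rewrite !inE.
Qed.

Variables (T : R) (W : R -> {RV P >-> R}).
Hypothesis brownianW : standard_brownian_motion P T W.

Lemma brownian_law t (A : set R) : 0 < t -> t <= T -> measurable A ->
  P (W t @^-1` A) = N (Num.sqrt t) A.
Proof.
move=> t0 tT mA; have [W0 _ lawW _] := brownianW.
rewrite -[t in RHS]subr0 -lawW// /pushforward.
have m0 (f : {RV P >-> R}) : measurable (f @^-1` A).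
  by rewrite -[X in measurable X]setTI; exact: measurable_funP.
apply: probability_ae_eq => //.
  by rewrite -[X in measurable X]setTI; apply: measurable_funB.
by apply: filterS W0 => w /= ->; rewrite subr0.
Qed.

(* [W 0] vanishes only almost surely: starting from [W h] instead of
   [W h - W 0] makes [W (n h)] a sum of increments at every sample point. *)
Definition increment (h : R) (k : nat) (w : Omega) : R :=
  W (k.+1%:R * h) w - (if k is 0 then 0 else W (k%:R * h) w).

Lemma sum_increment h n w :
  \sum_(k < n.+1) increment h k w = W (n.+1%:R * h) w.
Proof.
elim: n => [|n IH]; first by rewrite big_ord1 /increment subr0.
by rewrite big_ord_recr/= IH /increment addrC subrK.
Qed.

Lemma measurable_increment h k : measurable_fun setT (increment h k).
Proof.
case: k => [|k]; last by apply: measurable_funB.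
by apply: (@measurable_funB _ _ _ _ (W (1 * h)) (cst 0)).
Qed.

Lemma increment_law h k (A : set R) :
  0 < h -> k.+1%:R * h <= T -> measurable A ->
  P (increment h k @^-1` A) = N (Num.sqrt h) A.
Proof.
move=> h0; case: k => [|k] kT mA.
  rewrite mul1r in kT; rewrite -brownian_law// (_ : increment h 0 = W h)//.
  by apply/funext => w; rewrite /increment mul1r subr0.
have [_ _ lawW _] := brownianW.
have kk : k.+2%:R * h - k.+1%:R * h = h.
  by rewrite -mulrBl -natrB// subSnn mul1r.
rewrite -[h in RHS]kk -lawW//.
- by rewrite mulr_ge0// ltW.
- by rewrite ltr_pM2r// ltr_nat.
Qed.

Definition increments_in h n (A : nat -> set R) : set Omega :=
  [set w | forall k, (k < n)%N -> A k (increment h k w)].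

Lemma increments_in_past h n (A : nat -> set R) : 0 <= h ->
  (forall k, measurable (A k)) ->
  natural_filtration W (n%:R * h) (increments_in h n A).
Proof.
move=> h0 mA.
rewrite (_ : increments_in h n A =
    \bigcap_(k in [set k | (k < n)%N]) (increment h k @^-1` A k)) //.
pose D : set R := `[0, n%:R * h].
pose TD :=
  g_sigma_algebraType (\bigcup_(s in D) g_sigma_algebra_preimage (W s)).
have mW k : (k <= n)%N -> measurable_fun [set: TD] (W (k%:R * h)).
  move=> kn; apply: (@measurable_sigma_process _ Omega R D (fun s => W s)).
  by rewrite /D/= in_itv/= mulr_ge0//= ler_wpM2r// ler_nat.
have mI k : (k < n)%N -> measurable_fun [set: TD] (increment h k).
  move=> kn; apply: measurable_funB; first exact: mW.
  by case: k kn => [|k] kn; [exact: measurable_cst|apply: mW; exact: ltnW].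
have : measurable
    (\bigcap_(k in [set k | (k < n)%N]) (increment h k @^-1` A k) : set TD).
  apply: fin_bigcap_measurable; first exact: finite_II.
  by move=> k kn; rewrite -[X in measurable X]setTI; exact: mI.
by [].
Qed.

(** By induction on [n]: the last increment is independent of the past at its starting time, to
    which the event on the earlier increments belongs. *)
Lemma increments_independent h n (A : nat -> set R) : 0 < h -> n%:R * h <= T ->
  (forall k, measurable (A k)) ->
  P (increments_in h n A) = (\prod_(k < n) N (Num.sqrt h) (A k))%E.
Proof.
move=> h0 + mA; elim: n => [_|n IH nT].
  rewrite big_ord0 -(@probability_setT _ _ _ P); congr (P _).
  by apply/seteqP; split.
rewrite big_ord_recr/= -(increment_law h0 nT)//.
have nT' : n%:R * h <= T.
  by apply: le_trans nT; rewrite ler_wpM2r ?ler_nat// ltW.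
have -> : increments_in h n.+1 A =
    increment h n @^-1` A n `&` increments_in h n A.
  apply/seteqP; split=> [w h1|w [h1 h2] k]; first split; [exact: h1| |].
    by move=> k kn; apply: h1; exact: ltnW.
  by rewrite ltnS leq_eqVlt => /predU1P[->//|]; exact: h2.
(* The first increment is [W h], not [W h - W 0], so it is treated apart; there the event on earlier
   increments is the whole space. *)
rewrite -IH// muleC; case: n nT nT' {IH} => [|n] nT nT'.
  rewrite (_ : increments_in h 0 A = setT) ?setIT ?probability_setT ?mule1//.
  by apply/seteqP; split.
have [_ + _ _] := brownianW.
move=> /(_ (n.+1%:R * h) (n.+2%:R * h)); apply => //.
- by rewrite mulr_ge0// ltW.
- by rewrite ler_wpM2r ?ler_nat// ltW.
- by exists (A n.+1) => //; rewrite setTI.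
- by apply: increments_in_past => //; exact: ltW.
Qed.

End brownian_increments.

(** * Joint increments of two independent Brownian motions *)

Section two_brownian_motions.
Context {d : measure_display} {Omega : measurableType d} {R : realType}.
Variables (P : probability Omega R) (T : R) (W B : R -> {RV P >-> R}).
Hypotheses (brownianW : standard_brownian_motion P T W)
  (brownianB : standard_brownian_motion P T B)
  (indepWB : independent_processes P T W B).

Definition joint_increment (h : R) n (i : 'I_n + 'I_n) : Omega -> R :=
  match i with inl k => increment W h k | inr k => increment B h k end.

(** A rectangle event is an event on [W] intersected with an event on [B]; independence of the
    processes separates them, and each factor is a product over its own increments. *)
Lemma joint_increment_iid (h : R) n : 0 < h -> n%:R * h <= T ->
  iid P (normal_prob 0 (Num.sqrt h)) (@joint_increment h n).
Proof.
move=> h0 nT; split=> [[k|k]|A mA]; [exact: measurable_increment..|].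
(* [increments_in] takes sets indexed by all naturals; beyond [n] the full set is supplied. *)
pose ext (g : 'I_n -> set R) (k : nat) :=
  if insub k is Some i then g i else setT.
have extE g (i : 'I_n) : ext g i = g i by rewrite /ext valK.
have mext (g : 'I_n -> set R) :
    (forall i, measurable (g i)) -> forall k, measurable (ext g k).
  by move=> mg k; rewrite /ext; case: insubP.
pose AW := ext (A \o inl); pose AB := ext (A \o inr).
have mAW k : measurable (AW k) by exact: (mext _ (fun i => mA (inl i))).
have mAB k : measurable (AB k) by exact: (mext _ (fun i => mA (inr i))).
have -> : [set w | forall i, A i (joint_increment h i w)] =
    increments_in W h n AW `&` increments_in B h n AB.
  apply/seteqP; split=> [w Aw|w [h1 h2] [i|i]].
  - split=> k kn.
      rewrite (_ : AW k = A (inl (Ordinal kn))); first exact: (Aw (inl _)).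
      exact: (extE _ (Ordinal kn)).
    rewrite (_ : AB k = A (inr (Ordinal kn))); first exact: (Aw (inr _)).
    exact: (extE _ (Ordinal kn)).
  - by have := h1 i (ltn_ord i); rewrite /AW extE.
  - by have := h2 i (ltn_ord i); rewrite /AB extE.
have past (X : R -> {RV P >-> R}) (A' : nat -> set R) :
    (forall k, measurable (A' k)) ->
    sigma_process `[0, T] X (increments_in X h n A').
  move=> mA'; have := @increments_in_past _ _ _ P X h n A' (ltW h0) mA'.
  apply: smallest_sub; first exact: smallest_sigma_algebra.
  move=> C [s /= s0n XC]; apply: sub_sigma_algebra; exists s => //=.
  by move: s0n; rewrite !in_itv/= => /andP[-> /le_trans ->].
rewrite (indepWB (past W _ mAW) (past B _ mAB)).
rewrite (increments_independent brownianW)//.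
rewrite (increments_independent brownianB)//.
rewrite big_sumType/=; congr (_ * _)%E; apply: eq_bigr => i _.
  by rewrite /AW extE.
by rewrite /AB extE.
Qed.

Lemma integrable_joint_increment (h : R) n (i : 'I_n + 'I_n) :
  0 < h -> n%:R * h <= T -> P.-integrable setT (EFin \o joint_increment h i).
Proof.
move=> h0 nT.
have kT (k : 'I_n) : k.+1%:R * h <= T.
  by apply: le_trans nT; rewrite ler_wpM2r ?ler_nat// ltW.
have mU : measurable_fun setT (joint_increment h i).
  by case: i => k; exact: measurable_increment.
have law (A : set R) : measurable A ->
    P (joint_increment h i @^-1` A) = normal_prob 0 (Num.sqrt h) A.
  case: i {mU} => k mA.
    exact: (increment_law brownianW h0 (kT k) mA).
  exact: (increment_law brownianB h0 (kT k) mA).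
apply/integrableP; split; first exact/measurable_EFinP.
pose f : measurableTypeR R -> \bar R := fun x => `|x%:E|%E.
have mf : measurable_fun setT f by exact: measurableT_comp.
(* The canonical measurable structure of [R] has another display than the one
   on which [normal_prob] is a measure, although the sets are the same. *)
pose V : Omega -> measurableTypeR R := joint_increment h i.
have mV : measurable_fun setT V := mU.
pose U : {mfun Omega >-> measurableTypeR R} :=
  HB.pack V (isMeasurableFun.Build _ _ _ _ _ mV).
rewrite (_ : (\int[P]_w _ = \int[normal_prob 0 (Num.sqrt h)]_x f x)%E);
  last first.
  rewrite -[LHS](ge0_integral_distribution U mf); last first.
    by move=> x; exact: abse_ge0.
  by apply: eq_measure_integral => A mA _; exact: law.
by apply: abs_moment_normal_prob_lty; rewrite gt_eqF// sqrtr_gt0.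
Qed.

End two_brownian_motions.

(** * The contradiction on a grid of four steps *)

Theorem proposition2p1 (d : measure_display) (Omega : measurableType d)
    (R : realType) (P : probability Omega R) (T : R) (T_gt0 : 0 < T)
    (W B : R -> {RV P >-> R})
    (W_brownian : standard_brownian_motion P T W)
    (B_brownian : standard_brownian_motion P T B)
    (WB_indep : independent_processes P T W B) :
  ~ markov_process P T (beta_bar T W B).
Proof.
set X := beta_bar T W B => markovX.
pose h := T / 4; have h0 : 0 < h by rewrite divr_gt0.
have hT : 4%:R * h = T by rewrite /h; field.
have nT : 4%:R * h <= T by rewrite hT.
pose U := joint_increment W B h (n := 4).
have iidU : iid P (normal_prob 0 (Num.sqrt h)) U.
  exact: (joint_increment_iid W_brownian B_brownian WB_indep h0 nT).
have iU i : P.-integrable setT (EFin \o U i).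
  exact: (integrable_joint_increment W_brownian B_brownian _ h0 nT).
have s0 : Num.sqrt h != 0 by rewrite gt_eqF// sqrtr_gt0.
(* The last two increments of [W] have coefficient -1/2 in [X (2 * h)]; flipping their signs makes
   all its nonzero coefficients equal to 1/2. *)
pose sgn (i : 'I_4 + 'I_4) := if i is inl k then (1 < k)%N else false.
pose V i w := (-1) ^+ sgn i * U i w.
have iidV : iid P (normal_prob 0 (Num.sqrt h)) V.
  by apply: iid_sign iidU => A mA; exact: normal_prob_sym.
have iV i : P.-integrable setT (EFin \o V i).
  by apply: eq_integrable (integrableZl measurableT ((-1) ^+ sgn i) (iU i)).
(* [lin a b] has coefficients [a] on the increments of [W], [b] on those of
   [B], and 0 beyond the end of the lists. *)
pose lin (a b : seq R) (i : 'I_4 + 'I_4) :=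
  match i with inl k => a`_k | inr k => b`_k end.
have integrable_lin (a b : seq R) (K : pred ('I_4 + 'I_4)) :
    P.-integrable setT (EFin \o (fun w => \sum_(i | K i) lin a b i * U i w)).
  rewrite (_ : _ \o _ = fun w => \sum_(i | K i) (lin a b i * U i w)%:E)%E;
    last first.
    by apply/funext => w /=; rewrite sumEFin.
  apply: integrable_sum => // i _.
  by apply: eq_integrable (integrableZl measurableT (lin a b i) (iU i)).
pose w_ k := increment W h k; pose b_ k := increment B h k.
have Wh w : W h w = w_ 0%N w by rewrite /w_ /increment mul1r subr0.
have Bh w : B h w = b_ 0%N w by rewrite /b_ /increment mul1r subr0.
have W2h w : W (2 * h) w = w_ 0%N w + w_ 1%N w.
  by rewrite -(sum_increment W h 1) !big_ord_recl big_ord0 addr0.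
have B2h w : B (2 * h) w = b_ 0%N w + b_ 1%N w.
  by rewrite -(sum_increment B h 1) !big_ord_recl big_ord0 addr0.
have WT w : W T w = w_ 0%N w + w_ 1%N w + w_ 2%N w + w_ 3%N w.
  by rewrite -[T]hT -(sum_increment W h 3) !big_ord_recl big_ord0 addr0 !addrA.
have BT w : B T w = b_ 0%N w + b_ 1%N w + b_ 2%N w + b_ 3%N w.
  by rewrite -[T]hT -(sum_increment B h 3) !big_ord_recl big_ord0 addr0 !addrA.
have T0 : T != 0 by rewrite gt_eqF.
have Xh w : X h w = \sum_i lin [:: 3/4; -1/4; -1/4; -1/4] [:: 1/4] i * U i w.
  rewrite big_sumType !big_ord_recl !big_ord0 /=.
  rewrite /X /beta_bar Wh Bh WT (_ : h / T = 1/4); last by rewrite /h; field.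
  by rewrite /w_ /b_ /bump /= !add1n; field.
have X2h w : X (2 * h) w =
    \sum_i lin [:: 1/2; 1/2; -1/2; -1/2] [:: 1/2; 1/2] i * U i w.
  rewrite big_sumType !big_ord_recl !big_ord0 /=.
  rewrite /X /beta_bar W2h B2h WT (_ : 2 * h / T = 1/2);
    last by rewrite /h; field.
  by rewrite /w_ /b_ /bump /= !add1n; field.
have XT w : X T w = \sum_i lin [::] [:: 1; 1; 1; 1] i * U i w.
  rewrite big_sumType !big_ord_recl !big_ord0 /=.
  rewrite /X /beta_bar BT divff//.
  by rewrite /w_ /b_ /bump /= !add1n; field.
have mX u : measurable_fun setT (X u).
  by apply: measurable_funD; [apply: measurable_funB => //|];
    apply: measurable_funM.
have iXh : P.-integrable setT (EFin \o X h).
  by apply: eq_integrable (integrable_lin _ _ xpredT) => // w _ /=; rewrite Xh.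
have iX2h : P.-integrable setT (EFin \o X (2 * h)).
  by apply: eq_integrable (integrable_lin _ _ xpredT) => // w _ /=; rewrite X2h.
have iXT : P.-integrable setT (EFin \o X T).
  by apply: eq_integrable (integrable_lin _ _ xpredT) => // w _ /=; rewrite XT.
have reg C : measurable C ->
    \int[P]_(w in X (2 * h) @^-1` C) (X h w - 5/12 * X (2 * h) w) = 0.
  move=> mC.
  (* The six variables that occur in [X (2 * h)]. In terms of [V], the coefficients of [X h] sum to
     5/4 and those of [X (2 * h)] to 3; the ratio 5/12 makes the coefficients [y] of the residual
     sum to 0. *)
  pose K (i : 'I_4 + 'I_4) := if i is inr k then (k < 2)%N else true.
  pose c := lin [:: 1/2; 1/2; 1/2; 1/2] [:: 1/2; 1/2].
  pose y := lin [:: 13/24; -11/24; 1/24; 1/24] [:: 1/24; -5/24].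
  rewrite (_ : X (2 * h) @^-1` C = [set w | C (\sum_i c i * V i w)]);
    last first.
    apply/funext => w /=; congr C.
    rewrite X2h !big_sumType !big_ord_recl !big_ord0.
    by rewrite /V /= /bump /=; field.
  have cK i : K i -> c i = 1/2 by case: i => -[[|[|[|[|]]]]].
  have yK : \sum_(i | K i) y i = 0.
    by rewrite big_mkcond big_sumType !big_ord_recl !big_ord0 /=; field.
  rewrite -[RHS](Rintegral_exchange_sum iidV iV mC cK yK).
  apply: eq_Rintegral => w _; rewrite Xh X2h.
  rewrite [in RHS]big_mkcond !big_sumType !big_ord_recl !big_ord0.
  by rewrite /V /= /bump /=; field.
have m0 : measurable [set x : R | 0 < x].
  rewrite (_ : [set _ | _] = `]0, +oo[)//.
  by apply/seteqP; split => x /=; rewrite in_itv/= andbT.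
pose E := X T @^-1` [set x : R | 0 < x].
have mE : measurable E by rewrite -[E]setTI; exact: mX.
have intY : \int[P]_(w in E) (X h w - 5/12 * X (2 * h) w) = 0.
  (* Past [h], present [2 * h] and future [T]. *)
  apply: (markov_regression (T := T) (X := X) _ markovX) => //.
  - exact: ltW.
  - by rewrite mulr_natl mulr2n lerDl ltW.
  - by move: h0 hT; lra.
have EE : E = [set w |
    [set x : R | 0 < x] (\sum_i lin [::] [:: 1; 1; 1; 1] i * U i w)].
  by apply/funext => w; rewrite /E /= XT.
(* Coefficients of the residual plus [X T / 24] on the unflipped increments. The residual alone has
   sum -4/24 on the increments of [B]; adding 1/24 to each of the four brings it to 0. *)
pose yW := lin [:: 13/24; -11/24; -1/24; -1/24] [::].
pose yB := lin [::] [:: 2/24; -4/24; 1/24; 1/24].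
pose isW (i : 'I_4 + 'I_4) := if i is inl _ then true else false.
have intW : \int[P]_(w in E) (\sum_(i | isW i) yW i * U i w) = 0.
  rewrite EE; apply: (Rintegral_exchange_sum (a := 0) iidU iU) => //.
    by case=> // -[[|[|[|[|]]]]].
  by rewrite big_mkcond big_sumType !big_ord_recl !big_ord0 /=; field.
have intB : \int[P]_(w in E) (\sum_(i | predC isW i) yB i * U i w) = 0.
  rewrite EE; apply: (Rintegral_exchange_sum (a := 1) iidU iU) => //.
    by case=> // -[[|[|[|[|]]]]].
  by rewrite big_mkcond big_sumType !big_ord_recl !big_ord0 /=; field.
have iE (Z : Omega -> R) :
    P.-integrable setT (EFin \o Z) -> P.-integrable E (EFin \o Z).
  exact: integrableS.
have iY : P.-integrable setT (EFin \o (fun w => X h w - 5/12 * X (2 * h) w)).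
  have i2 := integrableZl measurableT (5/12) iX2h.
  by apply: eq_integrable (integrableB measurableT iXh i2).
have intXT : \int[P]_(w in E) X T w = 0.
  have decomp w : X T w = 24 * ((\sum_(i | isW i) yW i * U i w +
      \sum_(i | predC isW i) yB i * U i w) - (X h w - 5/12 * X (2 * h) w)).
    rewrite XT (big_mkcond (fun i => isW i)).
    rewrite (big_mkcond (fun i => predC isW i)).
    rewrite Xh X2h !big_sumType.
    by rewrite !big_ord_recl !big_ord0 /= /bump /=; field.
  have iS : P.-integrable E (EFin \o (fun w => \sum_(i | isW i) yW i * U i w +
      \sum_(i | predC isW i) yB i * U i w)).
    by apply: eq_integrable (integrableD mE (iE _ (integrable_lin _ _ isW))
      (iE _ (integrable_lin _ _ (predC isW)))).
  under eq_Rintegral do rewrite decomp.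
  rewrite RintegralZl//.
    rewrite RintegralB// ?intY; last exact: iE.
    rewrite RintegralD// ?intW ?intB; [ring|apply: iE..];
      exact: integrable_lin.
  by apply: eq_integrable (integrableB mE iS (iE _ iY)).
have PE0 : P E = 0%E.
  have EN : E = [set w | - X T w < 0].
    by apply/funext => w; rewrite /E/= oppr_lt0.
  (* [E] is the set where [- X T] is negative, and the integral of [- X T] over it is 0. *)
  rewrite EN; apply: null_set_lt0.
    by apply: eq_integrable (integrableN iXT).
  rewrite -EN; have := integralN (integrable_add_def mE (iE _ iXT)) => /= ->.
  rewrite -(fineK (integrable_fin_num mE (iE _ iXT))).
  by rewrite -[fine _]/(Rintegral P E (X T)) intXT oppe0.
have : P E = normal_prob 0 (Num.sqrt T) [set x : R | 0 < x].
  rewrite -(brownian_law B_brownian)//; congr (P _).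
  (* At time [T] the bridge part cancels and the process equals [B T], of law N(0, T). *)
  by apply/funext => w; rewrite /E /= /X /beta_bar divff// !mul1r subrr add0r.
rewrite PE0 => /esym/eqP; rewrite gt_eqF//; apply: normal_prob_gt0.
by rewrite gt_eqF// sqrtr_gt0.
Qed.
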